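(* Let $q$ be a positive integer, and let $r$ be a non-negative integer such that $0\leq r<q$. Then \[\lim_{n\rightarrow\infty}\frac{\sum_{j=0}^{\lfloor (n-r)/q\rfloor} c(n,r+jq)}{n!}=\lim_{n\rightarrow\infty}\frac{c(n,r)+c(n,q+r)+\cdots+c(n,q\lfloor (n-r)/q\rfloor+r)}{n!}=\frac{1}{q}.\]
   Context: $c(n,k)$ denotes the number of permutations of length $n$ (i.e. of $\{1,\dots,n\}$) with exactly $k$ cycles (the signless Stirling numbers of the first kind), fixed points counting as cycles of length 1. The two expressions under the limits are the same sum, written in two ways. *)

(* Defs.v *)
From HB Require Import structures.
From mathcomp Require Import all_boot all_order all_algebra all_fingroup.

Set Implicit Arguments.
Unset Strict Implicit.
Unset Printing Implicit Defensive.

(* Signless Stirling numbers of the first kind.  [porbits s] is the set of all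
   orbits of [s], singletons included, so fixed points count as cycles. *)
Definition stirling1 (n k : nat) : nat :=
  #|[set s : 'S_n | #|porbits s| == k]|.

(* Main.v *)
(* Let p n k be the proportion of permutations of length n whose number of
   cycles is congruent to k mod q.  The recurrence for the Stirling numbers says
   that p n is the law at time n of a walk on Z/q which, at step n, moves forward
   with probability 1/(n+1) and otherwise stays put.  Writing d for the deviation
   of p from the uniform law, sum_k d(n,k)^2 decreases at step n by
   n/(n+1)^2 sum_k (d(n,k+1) - d(n,k))^2, which by a Poincare inequality on the
   cycle is at least a constant multiple of 1/n times the sum itself; since the
   harmonic series diverges, the deviation tends to 0. *)
Require Import Defs.
From HB Require Import structures.
From mathcomp Require Import all_boot all_order all_algebra all_fingroup.
From mathcomp Require Import all_classical all_reals all_analysis.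
From mathcomp Require Import zify ring lra.

Set Implicit Arguments.
Unset Strict Implicit.
Unset Printing Implicit Defensive.

Import Order.TTheory GRing.Theory Num.Theory.
Import numFieldNormedType.Exports.

Local Open Scope classical_set_scope.
Local Open Scope ring_scope.

(** * Cycle counts and the Stirling recurrence *)

Lemma porbit_lift_perm n (i : 'I_n.+1) (s : 'S_n) (k : 'I_n) :
  porbit (lift_perm i i s) (lift i k) = (lift i @: porbit s k)%SET.
Proof.
have liftX m : (lift_perm i i s ^+ m)%g (lift i k) = lift i ((s ^+ m)%g k).
  by elim: m => [|m IHm]; rewrite ?expg0 ?perm1 // !expgSr !permM IHm lift_perm_lift.
apply/setP => x; apply/porbitP/imsetP => [[m ->]|[_ /porbitP[m ->] ->]].
  by exists ((s ^+ m)%g k); rewrite ?mem_porbit.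
by exists m.
Qed.

Lemma porbit_lift_perm_id n (i : 'I_n.+1) (s : 'S_n) :
  porbit (lift_perm i i s) i = [set i]%SET.
Proof.
apply/setP => x; rewrite inE; apply/porbitP/eqP => [[m ->]|->]; last first.
  by exists 0%N; rewrite expg0 perm1.
by elim: m => [|m IHm]; rewrite ?expg0 ?perm1 // expgSr permM IHm lift_perm_id.
Qed.

(** The orbits are the singleton of the fixed point [i] and the lifts of the orbits of [s]. *)
Lemma card_porbits_lift_perm n (i : 'I_n.+1) (s : 'S_n) :
  #|porbits (lift_perm i i s)| = #|porbits s|.+1.
Proof.
have -> : porbits (lift_perm i i s) =
    ([set i] |: [set [set lift i x | x in A] | A : {set 'I_n} in porbits s])%SET.
  apply/setP => A; rewrite !inE; apply/imsetP/orP.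
    case=> x _ ->; case: (unliftP i x) => [k|] ->.
      right; rewrite porbit_lift_perm; apply/imsetP; exists (porbit s k) => //.
      exact: imset_f.
    by left; rewrite porbit_lift_perm_id.
  case=> [/eqP->|/imsetP[_ /imsetP[k _ ->] ->]].
    by exists i; rewrite ?porbit_lift_perm_id.
  by exists (lift i k); rewrite ?porbit_lift_perm.
rewrite cardsU1 card_imset; last exact/imset_inj/lift_inj.
rewrite (_ : [set i]%SET \notin _) //; apply/imsetP => -[A _ /setP/(_ i)].
rewrite !inE eqxx => /esym/imsetP[k _ /eqP].
by rewrite (negPf (neq_lift _ _)).
Qed.

(** Every permutation factors uniquely in this form, [i] being the preimage of 0. Injectivity
    suffices, since both sides count (n+1)! elements. *)
Lemma sum_perm_lift (V : nmodType) n (F : 'S_n.+1 -> V) :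
  \sum_(s : 'S_n.+1) F s =
  \sum_(i < n.+1) \sum_(t : 'S_n) F (tperm ord0 i * lift_perm ord0 ord0 t)%g.
Proof.
pose h (u : 'I_n.+1 * 'S_n) := (tperm ord0 u.1 * lift_perm ord0 ord0 u.2)%g.
rewrite pair_big (reindex h) //=; apply: onW_bij.
apply: inj_card_bij => [[i s] [j t]|]; last first.
  by rewrite card_prod !card_Sn card_ord factS.
rewrite /h /= => eq_h.
have eq_ij : i = j.
  have: (tperm ord0 i * lift_perm ord0 ord0 s)%g i = ord0.
    by rewrite permM tpermR lift_perm_id.
  rewrite eq_h permM -[RHS](lift_perm_id ord0 ord0 t) => /perm_inj.
  by rewrite -[RHS](tpermR ord0 j) => /perm_inj.
subst j; move/mulgI: eq_h => eq_h; congr (_, _).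
apply/permP => k; have /(congr1 (fun p : 'S_n.+1 => p (lift ord0 k))) := eq_h.
by rewrite !lift_perm_lift => /lift_inj.
Qed.

(* Multiplying by the transposition (0 i), i != 0, merges the fixed point 0
   into the cycle of i: hence c(n+1, k+1) = c(n, k) + n c(n, k+1). *)
Lemma sum_porbitsS (V : nmodType) n (f : nat -> V) :
  \sum_(s : 'S_n.+1) f #|porbits s| =
  \sum_(s : 'S_n) f #|porbits s|.+1 + (\sum_(s : 'S_n) f #|porbits s|) *+ n.
Proof.
rewrite sum_perm_lift big_ord_recl; congr (_ + _).
  by apply: eq_bigr => s _; rewrite tperm1 mul1g card_porbits_lift_perm.
rewrite -[n in _ *+ n]card_ord -sumr_const; apply: eq_bigr => i _.
apply: eq_bigr => s _; congr f.
have := porbits_mul_tperm (lift_perm ord0 ord0 s) ord0 (lift ord0 i).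
rewrite porbit_lift_perm neq_lift card_porbits_lift_perm /=.
rewrite (_ : ord0 \notin _) /=; first by rewrite addn1 addn2 => -[].
by apply/imsetP => -[k _ /eqP]; rewrite (negPf (neq_lift _ _)).
Qed.

Lemma card_porbits_le n (s : 'S_n) : (#|porbits s| <= n)%N.
Proof. by rewrite -[leqRHS]card_ord leq_imset_card. Qed.

(** * Cycle counts in a residue class *)

Lemma sum_eqn_arith q r m n : (0 < q)%N -> (r < q)%N -> (m <= n)%N ->
  (\sum_(0 <= j < ((n - r) %/ q).+1) (m == r + j * q) = (m %% q == r))%N.
Proof.
move=> q0 rq mn.
have eqE j : (m == r + j * q)%N = (m %% q == r)%N && (j == m %/ q)%N.
  apply/eqP/andP => [->|[/eqP mr /eqP ->]]; last by rewrite -mr addnC -divn_eq.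
  by rewrite addnC modnMDl divnMDl // modn_small // divn_small // addn0.
under eq_bigr do rewrite eqE.
have [mr|_] := eqVneq (m %% q)%N r; last by rewrite big1.
(* The only possible index [m %/ q] lies in the range: [m - r] is [q] times it, and [m <= n]. *)
have lej : (m %/ q < ((n - r) %/ q).+1)%N.
  rewrite ltnS (_ : m %/ q = (m - r) %/ q)%N ?leq_div2r ?leq_sub2r //.
  by rewrite [in RHS](divn_eq m q) mr addnK mulnK.
rewrite big_mkord (bigD1 (Ordinal lej)) //= eqxx big1 // => j.
by rewrite -val_eqE /= => /negPf ->.
Qed.

Lemma sum_stirling1_arith q r n : (0 < q)%N -> (r < q)%N ->
  (\sum_(0 <= j < ((n - r) %/ q).+1) stirling1 n (r + j * q) =
   \sum_(s : 'S_n) (#|porbits s| %% q == r))%N.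
Proof.
move=> q0 rq; rewrite /stirling1.
under eq_bigr do rewrite cardsE -sum1_card big_mkcond /=.
rewrite exchange_big /=; apply: eq_bigr => s _.
by rewrite -(sum_eqn_arith q0 rq (card_porbits_le s)); apply: eq_bigr => j _;
  rewrite unfold_in.
Qed.

(** * A Poincare inequality on the cycle *)

(** Cauchy-Schwarz against the constant sequence 1. Singletons are treated apart so that the
    induction step can multiply by [m > 0]. *)
Lemma sqr_sum_le (R : realDomainType) (I : Type) (x : I -> R) (s : seq I) :
  (\sum_(i <- s) x i) ^+ 2 <= (size s)%:R * \sum_(i <- s) x i ^+ 2.
Proof.
elim: s => [|a s IHs]; first by rewrite !big_nil mulr0 expr0n.
case: s IHs => [_|b s]; first by rewrite !big_cons !big_nil !addr0 mul1r.
rewrite [X in X ^+ 2 <= _ -> _]lock; rewrite !(big_cons _ _ a) /= -lock.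
set S := \sum_(i <- b :: s) x i; set T := \sum_(i <- b :: s) x i ^+ 2.
set m := (size s).+1 => IHs; have m0 : 0 < m%:R :> R by rewrite ltr0n.
rewrite -natr1 -(ler_pM2l m0).
(* With the induction hypothesis, this square bounds the cross term: 2 a S <= T + m a^2, where a is
   [x a]. *)
have := sqr_ge0 (S - m%:R * x a).
nra.
Qed.

Lemma sum_sqr_sub (R : comRingType) (d : nat -> R) q :
  \sum_(i < q) \sum_(j < q) (d j - d i) ^+ 2 =
  (q%:R * \sum_(i < q) d i ^+ 2 - (\sum_(i < q) d i) ^+ 2) *+ 2.
Proof.
set S := \sum_(i < q) d i; set V := \sum_(i < q) d i ^+ 2.
transitivity (\sum_(i < q) (V - S * d i *+ 2 + q%:R * d i ^+ 2)).
  apply: eq_bigr => i _; rewrite /V /S mulr_suml -sumrMnl.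
  rewrite -[in q%:R](card_ord q) mulr_natl -sumr_const -sumrB -big_split /=.
  by apply: eq_bigr => j _; rewrite sqrrB.
rewrite big_split sumrB /= sumr_const card_ord -mulr_sumr -/V.
rewrite sumrMnl -mulr_sumr -/S -mulr_natl; ring.
Qed.

(** Telescope from [i] to [j] and apply Cauchy-Schwarz to the at most [q] increments. *)
Lemma sqr_sub_le (R : realDomainType) (d : nat -> R) q i j :
  (i < q)%N -> (j < q)%N ->
  (d j - d i) ^+ 2 <= q%:R * \sum_(k < q) (d k.+1 - d k) ^+ 2.
Proof.
wlog ij : i j / (i <= j)%N => [wl iq jq|_ jq].
  by have [ij|/ltnW ji] := leqP i j; [|rewrite -sqrrN opprB]; apply: wl.
rewrite -telescope_sumr // (le_trans (sqr_sum_le _ _)) // size_iota.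
have sq0 k : 0 <= (d k.+1 - d k) ^+ 2 := sqr_ge0 _.
apply: ler_pM; [exact: ler0n|exact: sumr_ge0|by rewrite ler_nat; lia|].
rewrite -(big_mkord predT (fun k => (d k.+1 - d k) ^+ 2)).
rewrite [leRHS](big_cat_nat (n := i)) //=; last by lia.
rewrite [X in _ <= _ + X](big_cat_nat (n := j)) //=; last by lia.
by rewrite addrCA ler_wpDr // addr_ge0 // sumr_ge0.
Qed.

Lemma sum_sqr_le (R : realDomainType) (d : nat -> R) q :
  \sum_(i < q) d i = 0 ->
  \sum_(i < q) d i ^+ 2 <= q%:R ^+ 2 * \sum_(k < q) (d k.+1 - d k) ^+ 2.
Proof.
case: q => [|q] d0; first by rewrite !big_ord0 mulr0.
have q0 : 0 < q.+1%:R :> R by rewrite ltr0n.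
have := sum_sqr_sub d q.+1; rewrite d0 expr0n subr0 => eqV.
set D := \sum_(k < _) (_ - _) ^+ 2; set V := \sum_(i < _) d i ^+ 2 in eqV *.
(* Bound each pairwise difference in [eqV] by [sqr_sub_le]. This yields twice the required
   inequality's left side; the spare [V] is dropped at the end. *)
have : q.+1%:R * V *+ 2 <= q.+1%:R * (q.+1%:R * (q.+1%:R * D)).
  rewrite -eqV; do 2![rewrite [leRHS]mulr_natl -[X in _ *+ X]card_ord -sumr_const;
    apply: ler_sum => ? _].
  exact: sqr_sub_le.
have D0 : 0 <= D by apply: sumr_ge0 => k _; rewrite sqr_ge0.
have V0 : 0 <= V by apply: sumr_ge0 => k _; rewrite sqr_ge0.
rewrite -mulrnAr ler_pM2l // mulr2n expr2 -mulrA; apply: le_trans.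
by rewrite lerDl.
Qed.

(** * Decay of the deviation *)

(* V n (1 + c H_n) is nonincreasing, where H_n is the harmonic sum. *)
Lemma cvg0_harmonic_decay (R : realType) (V : R^nat) (c : R) :
  0 < c -> (forall n, 0 <= V n) ->
  (forall n, V n.+1 <= V n * (1 - c * harmonic n)) -> V @ \oo --> (0 : R).
Proof.
move=> c0 V0 VS.
have H0 n : 0 <= series harmonic n :> R.
  by apply: sumr_ge0 => k _; exact: harmonic_ge0.
have bound n : V n * (1 + c * series harmonic n) <= V 0%N.
  elim: n => [|n]; first by rewrite /series /= big_geq // mulr0 addr0 mulr1.
  apply: le_trans; rewrite seriesSr.
  have := VS n; have := V0 n; have := H0 n; have := @harmonic_ge0 R n.
  set h := harmonic n; set H := series _ n => h0 Hn0 Vn0 VSn.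
  apply: (@le_trans _ _ (V n * (1 - c * h) * (1 + c * (H + h)))).
    by apply: ler_wpM2r => //; rewrite addr_ge0 // mulr_ge0 ?addr_ge0 // ltW.
  rewrite -mulrA ler_wpM2l //.
  (* This product is exactly the gap in (1 - c h) (1 + c (H + h)) <= 1 + c H. *)
  have : 0 <= (c * h) * (c * (H + h)) by rewrite !mulr_ge0 ?addr_ge0 // ltW.
  nra.
have Hoo : series (@harmonic R) @ \oo --> +oo.
  apply: nondecreasing_dvgn_lt; last exact: dvg_harmonic.
  by apply/nondecreasing_series => k _ _; exact: harmonic_ge0.
apply: (@squeeze_cvgr _ _ _ _ (cst 0) (fun n => V 0%N * (1 + c * series harmonic n)^-1)).
- apply: nearW => n; rewrite V0 /= ler_pdivlMr ?bound //.
  by rewrite ltr_wpDr // mulr_ge0 // ltW.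
- exact: cvg_cst.
rewrite -[X in _ --> X](mulr0 (V 0%N)); apply: cvgMr.
apply/gtr0_cvgV0.
  by apply: nearW => n; rewrite ltr_wpDr // mulr_ge0 // ltW.
apply/cvgryPge => A.
near=> n.
have : A / c <= series harmonic n by near: n; move/cvgryPge: Hoo; exact.
rewrite ler_pdivrMr // mulrC => /le_trans; apply.
by rewrite lerDr.
Unshelve. all: by end_near.
Qed.

Lemma lazy_cycle_cvg0 (R : realType) q (d : nat -> nat -> R) (k : nat) :
  (forall n, d n q = d n 0%N) ->
  (forall n, \sum_(i < q) d n i = 0) ->
  (forall n i, d n.+1 i.+1 = (1 - harmonic n) * d n i.+1 + harmonic n * d n i) ->
  (k < q)%N -> d ^~ k @ \oo --> (0 : R).
Proof.
move=> dq d0 dS kq.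
pose V n := \sum_(i < q) d n i ^+ 2.
(* By periodicity, shifting the index only permutes the terms. *)
have shift n : V n = \sum_(i < q) d n i.+1 ^+ 2.
  rewrite /V; move: (dq n); case: (q) => [|m] dm; first by rewrite !big_ord0.
  by rewrite big_ord_recl big_ord_recr /= dm addrC.
pose D n := \sum_(i < q) (d n i.+1 - d n i) ^+ 2.
have VS n : V n.+1 = V n - harmonic n * (1 - harmonic n) * D n.
  (* Variance identity for a two-point mixture: ((1-h) x + h y)^2 = (1-h) x^2 + h y^2 - h (1-h)
     (x-y)^2. *)
  rewrite shift; transitivity (\sum_(i < q) ((1 - harmonic n) * d n i.+1 ^+ 2
      + harmonic n * d n i ^+ 2
      - harmonic n * (1 - harmonic n) * (d n i.+1 - d n i) ^+ 2)).
    by apply: eq_bigr => i _; rewrite dS; ring.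
  by rewrite sumrB big_split /= -!mulr_sumr -shift -/(V n) -/(D n); ring.
have q0 : 0 < q%:R :> R by rewrite ltr0n; exact: leq_ltn_trans kq.
have V0 n : 0 <= V n by apply: sumr_ge0 => i _; exact: sqr_ge0.
have Vcvg : V @ \oo --> (0 : R).
  (* Start at time 1: [harmonic 0] is 1, so h (1-h) vanishes at time 0 and that step gives no
     decay. *)
  rewrite -cvg_shiftS /=.
  (* The factor q^2 is the Poincare constant. The 4 comes from (n+1)/(n+2)^2 >= 1/(4(n+1)), that is,
     n+2 <= 2(n+1). *)
  apply: (@cvg0_harmonic_decay _ _ ((4 * q%:R ^+ 2)^-1)) => [|n|n].
  - by rewrite invr_gt0 mulr_gt0 // exprn_gt0.
  - exact: V0.
  rewrite VS.
  have := sum_sqr_le (d0 n.+1); rewrite -/(V _) -/(D _) => VD.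
  have q2 : 0 < q%:R ^+ 2 :> R by rewrite exprn_gt0.
  have hh : 4^-1 * harmonic n <= harmonic n.+1 * (1 - harmonic n.+1) :> R.
    have n1 : 0 < n.+1%:R :> R by rewrite ltr0n.
    have n2 : 0 < n.+2%:R :> R by rewrite ltr0n.
    have n1' : 1 <= n.+1%:R :> R by rewrite ler1n.
    rewrite /= -(natr1 n.+1) -subr_ge0.
    have -> : (n.+1%:R + 1)^-1 * (1 - (n.+1%:R + 1)^-1) - 4^-1 * n.+1%:R^-1 =
        (4 * n.+1%:R ^+ 2 - (n.+1%:R + 1) ^+ 2) / (4 * n.+1%:R * (n.+1%:R + 1) ^+ 2) :> R.
      by field; rewrite !lt0r_neq0 // ltr_wpDl // ltW.
    rewrite divr_ge0 //; nra.
  rewrite -ler_pdivrMl // in VD.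
  have : (q%:R ^+ 2)^-1 * V n.+1 * (4^-1 * harmonic n) <=
      D n.+1 * (harmonic n.+1 * (1 - harmonic n.+1)).
    by apply: ler_pM => //; rewrite ?mulr_ge0 ?invr_ge0 ?harmonic_ge0 // ltW.
  rewrite -subr_ge0 => VDh; rewrite -subr_ge0; apply: le_trans VDh _.
  rewrite le_eqVlt; apply/orP; left; apply/eqP.
  by field; exact: lt0r_neq0.
have dV n : d n k ^+ 2 <= V n.
  by rewrite /V (bigD1 (Ordinal kq)) //= lerDl sumr_ge0 // => i _; exact: sqr_ge0.
apply/cvgr0Pnorm_lt => e e0.
have e20 : 0 < e ^+ 2 by rewrite exprn_gt0.
near=> n.
rewrite -(ltr_pXn2r (n := 2)) ?nnegrE ?normr_ge0 ?(ltW e0) //.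
rewrite -normrX ger0_norm ?sqr_ge0 // (le_lt_trans (dV n)) // -[V n]ger0_norm //.
by near: n; move/cvgr0Pnorm_lt: Vcvg; exact.
Unshelve. all: by end_near.
Qed.

(* For n < r the truncated subtraction leaves the single term c(n, r) = 0. *)
Theorem theorem3p1 (R : realType) (q r : nat) (hq : (0 < q)%N) (hr : (r < q)%N) :
  (fun n : nat =>
     (\sum_(0 <= j < ((n - r) %/ q).+1) stirling1 n (r + j * q))%N%:R / (n`!)%:R : R)
    @ \oo --> (q%:R^-1 : R).
Proof.
have q0 : q%:R != 0 :> R by rewrite pnatr_eq0 -lt0n.
pose p n k : R := (\sum_(s : 'S_n) (#|porbits s| == k %[mod q])%:R) / n`!%:R.
have f0 n : n`!%:R != 0 :> R by rewrite pnatr_eq0 -lt0n fact_gt0.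
have pq n : p n q = p n 0%N by rewrite /p modnn mod0n.
(* The Stirling recurrence divided by (n+1)!, with [harmonic n] = 1/(n+1). *)
have pS n i : p n.+1 i.+1 = (1 - harmonic n) * p n i.+1 + harmonic n * p n i.
  rewrite /p (sum_porbitsS n (fun m => (m == i.+1 %[mod q])%:R)) /=.
  under eq_bigr do rewrite -addn1 -[i.+1]addn1 eqn_modDr.
  have n0 : n.+1%:R != 0 :> R by rewrite pnatr_eq0.
  rewrite factS natrM -[_ *+ n]mulr_natl.
  by field; rewrite f0 ?nat1r ?natr1 n0.
have p1 n : \sum_(i < q) p n i = 1.
  rewrite -mulr_suml exchange_big /=.
  rewrite (eq_bigr (fun=> 1)) ?sumr_const ?card_Sn ?divff // => s _.
  have mq : (#|porbits s| %% q < q)%N by rewrite ltn_mod.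
  rewrite (bigD1 (Ordinal mq)) //= modn_mod eqxx big1 ?addr0 // => i.
  by rewrite -val_eqE /= eq_sym (modn_small (ltn_ord i)) => /negPf ->.
have -> : (fun n : nat => (\sum_(0 <= j < ((n - r) %/ q).+1)
    stirling1 n (r + j * q))%N%:R / (n`!)%:R : R) = p ^~ r.
  apply/funext => n; rewrite /p sum_stirling1_arith // natr_sum.
  by rewrite (modn_small hr).
(* Subtracting the uniform law gives total 0 and preserves the recurrence, whose weights sum to
   1. *)
apply/subr_cvg0; apply: (@lazy_cycle_cvg0 _ q (fun n k => p n k - q%:R^-1)) => //=.
- by move=> n; rewrite pq.
- by move=> n; rewrite sumrB p1 sumr_const card_ord -[_ *+ q]mulr_natl divff ?subrr.
- by move=> n i; rewrite pS /=; ring.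
Qed.
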